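(* Let $G=(V_1,E_1)$ be a connected graph with $|V_1|\ge 2$, and let $H=(V_2,E_2)$ be a $\kappa$-regular graph on $n=|V_2|\ge1$ vertices ($\kappa\ge0$) with adjacency matrix $A_H$. Put $q=\mathrm{QEC}(G)$, $\gamma_3=-2-\min\mathrm{ev}(A_H)$, and $$\Psi=\tfrac12\Big\{(n+1)q-(\kappa+2)+\sqrt{\big((n+1)q-(\kappa+2)\big)^2+4(\kappa+2)q}\Big\}.$$ Then $\mathrm{QEC}(G\odot H)=\Psi$ if one of the following holds: (i) $-2-\Psi\notin\mathrm{ev}(A_H)$, $\dfrac{\gamma_3^2+\gamma_3(\kappa+2)}{\gamma_3(n+1)+\kappa+2}<q<0$, and $\gamma_3<0$; (ii) $-2-\Psi\notin\mathrm{ev}(A_H)$, $q>0$, and $\gamma_3\le0$; (iii) $-2-\Psi\notin\mathrm{ev}(A_H)$, $q>\dfrac{\gamma_3^2+\gamma_3(\kappa+2)}{\gamma_3(n+1)+\kappa+2}$, and $\gamma_3>0$.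
   Context: All graphs are finite, simple, undirected. The corona graph $G\odot H$ is obtained by taking one copy of $G$ and $|V_1|$ disjoint copies of $H$, and joining the $i$-th vertex of $G$ to every vertex of the $i$-th copy of $H$. For a connected graph $X$ with distance matrix $D_X$, $\mathrm{QEC}(X)=\max\{\langle f,D_Xf\rangle : \langle f,f\rangle=1,\ \langle\mathbf 1,f\rangle=0\}$, $\mathbf 1$ the all-ones vector. $\mathrm{ev}(A)$ is the set of eigenvalues of $A$. *)

(* Defs.v *)
From HB Require Import structures.
From mathcomp Require Import all_boot all_order all_algebra.
From mathcomp Require Import boolp classical_sets functions reals.
From mathcomp Require Import topology normedtype derive.
From mathcomp Require Import ring lra.
Set Implicit Arguments.
Unset Strict Implicit.
Unset Printing Implicit Defensive.
Import Order.TTheory GRing.Theory Num.Theory.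
Import numFieldNormedType.Exports.

Record sgraph := SGraph {
  vertex :> finType;
  edge : rel vertex;
  edge_sym : symmetric edge;
  edge_irr : irreflexive edge
}.
Arguments edge {s} x y.

Definition connected_graph (G : sgraph) : Prop :=
  forall x y : G, connect edge x y.

Definition regular_graph (k : nat) (G : sgraph) : Prop :=
  forall x : G, #|[set y | edge x y]| = k.

Section Corona.
Variables G H : sgraph.

(* inl i is the vertex i of G; inr (i, h) is the vertex h of the copy of H
   attached to i. *)
Definition corona_edge : rel (G + G * H)%type := fun u v =>
  match u, v with
  | inl i, inl j => edge i j
  | inl i, inr (j, _) => i == j
  | inr (i, _), inl j => i == j
  | inr (i, h), inr (j, k) => (i == j) && edge h k
  end.

Lemma corona_sym : symmetric corona_edge.
Proof.
move=> [i|[i h]] [j|[j k]] /=; first exact: edge_sym.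
- exact: eq_sym.
- exact: eq_sym.
- by rewrite eq_sym edge_sym.
Qed.

Lemma corona_irr : irreflexive corona_edge.
Proof. by move=> [i|[i h]] /=; rewrite edge_irr ?andbF. Qed.

Definition corona : sgraph := SGraph corona_sym corona_irr.

Lemma corona_connected : connected_graph G -> connected_graph corona.
Proof.
move=> cG.
have base (i j : G) : connect corona_edge (inl i) (inl j).
  have /connectP[p] := cG i j.
  elim: p i => [|k p IH] i /=; first by move=> _ ->.
  move=> /andP[ik /IH{}IH] /IH; apply: connect_trans.
  exact: connect1.
pose pr (u : corona) : G := match u with inl i => i | inr (i, _) => i end.
have up (u : corona) : connect corona_edge (inl (pr u)) u.
  by case: u => [i|[i h]] //=; apply: connect1 => /=.
have down (u : corona) : connect corona_edge u (inl (pr u)).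
  by case: u => [i|[i h]] //=; apply: connect1 => /=.
move=> u v; apply: connect_trans (down u) _.
exact: connect_trans (base _ _) (up v).
Qed.

End Corona.

Definition walk (G : sgraph) (n : nat) (x y : G) : bool :=
  [exists p : n.-tuple G, path edge x p && (last x p == y)].

(* Least length of a walk from x to y. In a graph on m vertices, two connected
   vertices are joined by a walk of length < m; for vertices in different
   components the value is m. *)
Definition gdist (G : sgraph) (x y : G) : nat :=
  find (fun n => walk n x y) (iota 0 #|G|).

Lemma gdistP (G : sgraph) (x y : G) : connect edge x y ->
  walk (gdist x y) x y /\ forall n, walk n x y -> gdist x y <= n.
Proof.
move=> /connectP[p0 /shortenP[p pp up _] {p0} yE].
set s := iota 0 #|G|.
have wp : walk (size p) x y.
  by apply/existsP; exists (in_tuple p); rewrite pp -yE eqxx.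
have ltp : size p < #|G| by have := max_card [in x :: p]; rewrite (card_uniqP up).
have hs : has (fun n => walk n x y) s.
  by apply/hasP; exists (size p); rewrite // mem_iota.
have lt : gdist x y < #|G| by move: (hs); rewrite has_find size_iota.
split=> [|n wn]; first by have := nth_find 0 hs; rewrite nth_iota.
rewrite leqNgt; apply/negP => ltn.
have := before_find 0 (ltn : n < find (fun n => walk n x y) s).
by rewrite nth_iota ?add0n ?wn // (ltn_trans ltn).
Qed.

Local Open Scope ring_scope.

Definition adjmx (R : nzRingType) (G : sgraph) : 'M[R]_#|G| :=
  \matrix_(i, j) (edge (enum_val i) (enum_val j))%:R.

Definition distmx (R : nzRingType) (G : sgraph) : 'M[R]_#|G| :=
  \matrix_(i, j) (gdist (enum_val i) (enum_val j))%:R.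

Definition dot (R : nzRingType) (n : nat) (u v : 'cV[R]_n) : R :=
  \sum_i u i 0 * v i 0.

Local Open Scope classical_set_scope.

(* The set below is the image of a compact set, nonempty when G has at least two
   vertices; the supremum is then a maximum (QEC_max below). *)
Definition QEC (R : realType) (G : sgraph) : R :=
  sup [set dot f (distmx R G *m f) |
        f in [set f | dot f f = 1 /\ dot (const_mx 1) f = 0]].

Definition ev (R : realType) (n : nat) (A : 'M[R]_n) : set R :=
  [set a | eigenvalue A a].

(* For a symmetric A of positive size the infimum is a minimum (min_ev_min
   below). *)
Definition min_ev (R : realType) (n : nat) (A : 'M[R]_n) : R := inf (ev A).

Section Attained.
Variable R : realType.

Lemma dotC n (u v : 'cV[R]_n) : dot u v = dot v u.
Proof. by apply: eq_bigr => i _; rewrite mulrC. Qed.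

Lemma dotDr n (u v w : 'cV[R]_n) : dot u (v + w) = dot u v + dot u w.
Proof. by rewrite -big_split; apply: eq_bigr => i _; rewrite mxE mulrDr. Qed.

Lemma dotZr n a (u v : 'cV[R]_n) : dot u (a *: v) = a * dot u v.
Proof. by rewrite big_distrr; apply: eq_bigr => i _; rewrite mxE mulrCA. Qed.

Lemma dotDl n (u v w : 'cV[R]_n) : dot (v + w) u = dot v u + dot w u.
Proof. by rewrite dotC dotDr !(dotC u). Qed.

Lemma dotZl n a (u v : 'cV[R]_n) : dot (a *: v) u = a * dot v u.
Proof. by rewrite dotC dotZr dotC. Qed.

Lemma dotE n (u v : 'cV[R]_n) : dot u v = (u^T *m v) 0 0.
Proof. by rewrite mxE; apply: eq_bigr => i _; rewrite mxE. Qed.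

Lemma dot_mulmx n (A : 'M[R]_n) u v : dot u (A *m v) = dot (A^T *m u) v.
Proof. by rewrite !dotE trmx_mul trmxK mulmxA. Qed.

Lemma dot_ge0 n (u : 'cV[R]_n) : 0 <= dot u u.
Proof. by apply: sumr_ge0 => i _; rewrite -expr2 sqr_ge0. Qed.

Lemma dot_eq0 n (u : 'cV[R]_n) : dot u u = 0 -> u = 0.
Proof.
move=> /eqP; rewrite psumr_eq0 => [|i _]; last by rewrite -expr2 sqr_ge0.
move=> /allP u0; apply/colP => i; rewrite !mxE; apply/eqP.
by have := u0 i (mem_index_enum _); rewrite /= mulf_eq0 orbb.
Qed.

Lemma sum_cont (T : topologicalType) n (F : 'I_n -> T -> R) :
  (forall i, continuous (F i)) -> continuous (fun x => \sum_i F i x).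
Proof.
move=> cF; apply: (@continuous_big R _ +%R 0 xpredT) => [|i _]; last exact: cF.
exact: add_continuous.
Qed.

Lemma mul_cont (T : topologicalType) (f g : T -> R) :
  continuous f -> continuous g -> continuous (fun x => f x * g x).
Proof. by move=> cf cg x; exact: (cvgM (cf x) (cg x)). Qed.

Lemma tr_coord_cont n (i : 'I_n) : continuous (fun r : 'rV[R]_n => r^T i 0).
Proof.
have -> : (fun r : 'rV[R]_n => r^T i 0) = (fun r => r 0 i).
  by apply/funext => r; rewrite mxE.
exact: coord_continuous.
Qed.

Lemma lin_cont n (c : 'cV[R]_n) : continuous (fun r : 'rV[R]_n => dot c r^T).
Proof.
apply: sum_cont => i; apply: mul_cont (@tr_coord_cont n i).
exact: cst_continuous.
Qed.

Lemma quad_cont n (A : 'M[R]_n) :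
  continuous (fun r : 'rV[R]_n => dot r^T (A *m r^T)).
Proof.
apply: sum_cont => i; apply: mul_cont (@tr_coord_cont n i) _.
have -> : (fun r : 'rV[R]_n => (A *m r^T) i 0) =
          (fun r => \sum_j A i j * r^T j 0).
  by apply/funext => r; rewrite mxE.
apply: sum_cont => j; apply: mul_cont (@tr_coord_cont n j).
exact: cst_continuous.
Qed.

Lemma quad_max n (A : 'M[R]_n) (c : 'cV[R]_n) :
  let S := [set f | dot f f = 1 /\ dot c f = 0] in
  S !=set0 ->
  exists2 f, S f & forall g, S g -> dot g (A *m g) <= dot f (A *m f).
Proof.
move=> S [f0 Sf0]; pose T := [set r : 'rV[R]_n | S r^T].
have T0 : T !=set0 by exists f0^T; rewrite /T /= trmxK.
have Tcl : closed T.
  have -> : T = (fun r : 'rV[R]_n => dot r^T (1%:M *m r^T)) @^-1` [set 1]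
             `&` (fun r => dot c r^T) @^-1` [set 0].
    by apply/seteqP; split => r /=; rewrite /T /S /= mul1mx.
  have cl (a : R) : closed [set a].
    exact/accessible_closed_set1/hausdorff_accessible/Rhausdorff.
  have q := (continuous_closedP _).1 (@quad_cont n 1%:M) [set 1] (cl 1).
  have l := (continuous_closedP _).1 (@lin_cont n c) [set 0] (cl 0).
  by apply: closedI; [exact: q|exact: l].
have Tb : bounded_set T.
  exists 1; split => [|M M1 r [r1 _]]; first exact: num_real.
  rewrite /= (le_trans _ (ltW M1)) //.
  rewrite [leLHS]/Num.norm /= mx_normrE; apply/bigmax_leP; split => //= ij _.
  rewrite -(@ler_pXn2r _ 2) ?nnegrE // expr1n real_normK ?num_real // -r1.
  rewrite [leRHS](bigD1 ij.2) //= mxE (ord1 ij.1) -expr2 lerDl.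
  by apply: sumr_ge0 => i _; rewrite -expr2 sqr_ge0.
have [r Tr rmax] := EVT_max_rV T0 (bounded_closed_compact Tb Tcl)
  (continuous_subspaceT (@quad_cont _ A)).
exists r^T; first by move: Tr; rewrite inE.
by move=> g Sg; have := rmax g^T; rewrite inE /T /= trmxK; apply.
Qed.

Lemma QEC_max (G : sgraph) : (1 < #|G|)%N ->
  let S := [set dot f (distmx R G *m f) |
             f in [set f | dot f f = 1 /\ dot (const_mx 1) f = 0]] in
  S (QEC R G) /\ ubound S (QEC R G).
Proof.
move=> G1 S.
have [|f Sf fmax] := @quad_max _ (distmx R G) (const_mx 1).
  pose i0 : 'I_#|G| := Ordinal (ltnW G1); pose i1 : 'I_#|G| := Ordinal G1.
  pose d i : 'cV[R]_#|G| := delta_mx i 0.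
  have dd i (u : 'cV[R]_#|G|) : dot u (d i) = u i 0.
    rewrite /dot (bigD1 i) //= big1 ?addr0 => [|j /negPf ji].
      by rewrite mxE !eqxx mulr1.
    by rewrite mxE ji mulr0.
  exists ((Num.sqrt 2)^-1 *: (d i0 + (-1) *: d i1)) => /=; split.
    have dE i j : d i j 0 = (j == i)%:R by rewrite mxE eqxx andbT.
    rewrite !(dotDl, dotDr, dotZl, dotZr) !dd.
    rewrite !dE !eqxx (_ : i0 == i1 = false) // (_ : i1 == i0 = false) //.
    set z := (Num.sqrt 2)^-1; have z2 : z * z = 2^-1 :> R.
      by rewrite -invfM -expr2 sqr_sqrtr ?ler0n.
    rewrite /= mulr0n mulr1n; transitivity (2 * (z * z)); first by ring.
    by rewrite z2 mulfV ?pnatr_eq0.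
  by rewrite dotZr dotDr dotZr !dd !mxE mulN1r subrr mulr0.
have Sm : S (dot f (distmx R G *m f)) by exists f.
have ubm : ubound S (dot f (distmx R G *m f)) by move=> _ [g Sg <-]; exact: fmax.
have -> : QEC R G = dot f (distmx R G *m f); last by [].
apply/eqP; rewrite eq_le ge_sup //=; last by exists (dot f (distmx R G *m f)).
by apply: ub_le_sup => //; exists (dot f (distmx R G *m f)).
Qed.

Lemma min_ev_min n (A : 'M[R]_n) : (0 < n)%N -> A^T = A ->
  ev A (min_ev A) /\ lbound (ev A) (min_ev A).
Proof.
move=> n0 symA.
have [|f [f1 _] fmax] := @quad_max _ (- A) 0.
  exists (delta_mx (Ordinal n0) 0); split.
    rewrite /dot (bigD1 (Ordinal n0)) //= big1 ?addr0 => [|j /negPf ji].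
      by rewrite mxE !eqxx mulr1.
    by rewrite mxE ji mulr0.
  by rewrite /dot big1 // => j _; rewrite mxE mul0r.
set m := dot f (A *m f).
have rayleigh g : m * dot g g <= dot g (A *m g).
  have [g0|g0] := eqVneq (dot g g) 0.
    rewrite g0 mulr0 (dot_eq0 g0) mulmx0 /dot big1 // => i _.
    by rewrite !mxE mul0r.
  pose s := (Num.sqrt (dot g g))^-1.
  have s2 : s * s = (dot g g)^-1 by rewrite -invfM -expr2 sqr_sqrtr ?dot_ge0.
  have gp : 0 < dot g g by rewrite lt_def g0 dot_ge0.
  have dN u : dot u (- A *m u) = - dot u (A *m u).
    by rewrite mulNmx -scaleN1r dotZr mulN1r.
  have /fmax : dot (s *: g) (s *: g) = 1 /\ dot 0 (s *: g) = 0.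
    split; first by rewrite dotZl dotZr mulrA s2 mulVf.
    by rewrite /dot big1 // => i _; rewrite mxE mul0r.
  rewrite !dN lerN2 -scalemxAr dotZl dotZr mulrA s2 -/m => le_m.
  by rewrite mulrC -(ler_pdivlMl _ _ gp).
pose B := A - m%:M.
have BE g : B *m g = A *m g + (- m) *: g.
  by rewrite mulmxBl mul_scalar_mx scaleNr.
have Bge0 g : 0 <= dot g (B *m g).
  by rewrite BE dotDr dotZr mulNr subr_ge0.
have symB : B^T = B by rewrite /B linearB /= symA tr_scalar_mx.
have Bf0 : B *m f = 0.
  set w := B *m f; apply: dot_eq0.
  have fw : dot f w = 0 by rewrite /w BE dotDr dotZr f1 -/m mulr1 subrr.
  have fBw : dot f (B *m w) = dot w w by rewrite dot_mulmx symB.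
  set p := dot w w in fBw *; pose r := dot w (B *m w).
  have r0 : 0 <= r := Bge0 w.
  have := Bge0 (f + (- (p / (r + 1))) *: w).
  rewrite mulmxDr -scalemxAr -/w !(dotDl, dotDr, dotZl, dotZr) fw fBw -/p -/r.
  have r1 : r + 1 != 0 by rewrite gt_eqF // ltr_wpDl.
  set t := p / (r + 1); have -> : p = t * (r + 1) by rewrite /t divfK.
  move=> H; have t0 : t ^+ 2 <= 0 by nra.
  have -> : t = 0 by apply/eqP; rewrite -sqrf_eq0 eq_le t0 sqr_ge0.
  by rewrite mul0r.
have Af : A *m f = m *: f.
  by apply/eqP; rewrite -subr_eq0 -scaleNr -BE Bf0.
have Sm : ev A m.
  apply/eigenvalueP; exists f^T.
    by rewrite -{1}symA -trmx_mul Af linearZ.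
  apply: contra_eq_neq f1 => /(congr1 trmx); rewrite trmxK trmx0 => ->.
  by rewrite /dot big1 ?(eq_sym 0) ?oner_eq0 // => j _; rewrite mxE mul0r.
have lbm : lbound (ev A) m.
  move=> a /eigenvalueP[v vA v0].
  have gp : 0 < dot v^T v^T.
    rewrite lt_def dot_ge0 andbT; apply: contra_neq v0 => /dot_eq0.
    by move=> /(congr1 trmx); rewrite trmxK trmx0.
  rewrite -(ler_pM2r gp) (le_trans (rayleigh _)) //.
  by rewrite -{1}symA -trmx_mul vA linearZ dotZr.
have -> : min_ev A = m; last by [].
apply/eqP; rewrite eq_le lb_le_inf //=; last by exists m.
by rewrite andbT; apply: ge_inf => //; exists m.
Qed.

End Attained.

(* Main.v *)
(* Write a vector on the corona as values u on G and W_i on the copy of H at i,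
   and put s_i = u_i + sum W_i. If the total sum vanishes then
     <f, D f> = <s, D_G s> - sum_i <W_i, (2 + A_H) W_i>,
   so after bounding <s, D_G s> by q <s, s> the problem splits over the vertices
   of G. On the constant part of W_i what remains is a binary form in s_i and
   sum W_i, singular exactly when Psi is a root of
     (x - q) (x (n + 1) + kappa + 2) = n x^2;
   on its orthogonal complement one needs gamma3 <= Psi, which each of the three
   conditions gives by evaluating this quadratic at gamma3 or at 0, or because
   Psi > - (kappa + 2) / (n + 1). *)
Require Import Defs.
From HB Require Import structures.
From mathcomp Require Import all_boot all_order all_algebra.
From mathcomp Require Import boolp classical_sets reals.
From mathcomp Require Import ring lra zify.
Import Order.TTheory GRing.Theory Num.Theory.
Local Open Scope ring_scope.

Set Implicit Arguments.
Unset Strict Implicit.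
Unset Printing Implicit Defensive.

(** * Distances certified by potentials *)

Section Distance.
Variable G : sgraph.
Implicit Types (x y z : G) (n : nat).

Lemma walk0 x y : walk 0 x y = (x == y).
Proof.
apply/existsP/idP => [[p]|xy]; first by rewrite (tuple0 p).
by exists [tuple].
Qed.

Lemma walkS n x y : walk n.+1 x y = [exists z, walk n x z && edge z y].
Proof.
apply/existsP/existsP => [[p]|[z /andP[/existsP[p /andP[pp /eqP pz]] zy]]].
  case: p => -[//|a p] /= sp /andP[pp pl]; move: sp pp pl.
  case/lastP: p => [|p b].
    rewrite eqSS => /eqP <- /= /andP[xa _] /eqP <-; exists x.
    by rewrite walk0 eqxx.
  rewrite size_rcons eqSS => sp; rewrite last_rcons rcons_path.
  move=> /and3P[xa pp e] /eqP <-; exists (last a p); rewrite e andbT.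
  by apply/existsP; exists (Tuple (sp : size (a :: p) == n)); rewrite /= xa pp eqxx.
by exists [tuple of rcons p y]; rewrite rcons_path last_rcons pp pz zy eqxx.
Qed.

Lemma walk_potential (D : G -> nat) n x y :
  (forall z z', edge z z' -> D z' <= (D z).+1)%N ->
  walk n x y -> (D y <= D x + n)%N.
Proof.
move=> lip; elim: n y => [|n IH] y; first by rewrite walk0 addn0 => /eqP ->.
rewrite walkS => /existsP[z /andP[/IH + /lip]]; lia.
Qed.

Lemma walk_connect n x y : walk n x y -> connect edge x y.
Proof. by case/existsP=> p /andP[pp /eqP <-]; apply/connectP; exists p. Qed.

(** Following [desc] down from [y] produces a walk of length [D y], and [lip] excludes shorter ones;
    a guessed distance formula is thus checked edge by edge. *)
Lemma gdist_unique (D : G -> nat) x :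
  D x = 0%N ->
  (forall z z', edge z z' -> D z' <= (D z).+1)%N ->
  (forall y, y != x -> exists2 z, edge z y & D y = (D z).+1) ->
  forall y, gdist x y = D y.
Proof.
move=> Dx lip desc y; have wD n z : D z = n -> walk n x z.
  elim: n z => [|n IH] z Dz; have [zx|zx] := eqVneq z x.
  - by rewrite walk0 zx.
  - by have [z' _] := desc z zx; rewrite Dz.
  - by rewrite zx Dx in Dz.
  - rewrite walkS; have [z' e] := desc z zx; rewrite Dz => -[/esym/IH w].
    by apply/existsP; exists z'; rewrite w.
have [w min] := gdistP (walk_connect (wD _ y erefl)).
apply/eqP; rewrite eqn_leq min ?wD //=.
by have := walk_potential lip w; rewrite Dx.
Qed.

Lemma gdistxx x : gdist x x = 0%N.
Proof.
have [_ min] := gdistP (connect0 edge x).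
by apply/eqP; rewrite -leqn0 min // walk0.
Qed.

Hypothesis G_connected : connected_graph G.

Lemma gdist_eq0 x y : gdist x y = 0%N -> x = y.
Proof.
by have [w _] := gdistP (G_connected x y); move=> d0; move: w; rewrite d0 walk0 => /eqP.
Qed.

Lemma gdist_edge x y z : edge y z -> (gdist x z <= (gdist x y).+1)%N.
Proof.
move=> e; have [_ min] := gdistP (G_connected x z).
have [w _] := gdistP (G_connected x y).
by apply: min; rewrite walkS; apply/existsP; exists y; rewrite w.
Qed.

(** The neighbour is the last vertex but one of a shortest walk; [gdist_edge] shows that it is not
    closer still. *)
Lemma gdist_descent x y : y != x ->
  exists2 z, edge z y & gdist x y = (gdist x z).+1.
Proof.
move=> yx; have [w _] := gdistP (G_connected x y).
case E: (gdist x y) w => [|m] w.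
  by rewrite (gdist_eq0 E) eqxx in yx.
move: w; rewrite walkS => /existsP[z /andP[w e]]; exists z => //.
have [_ min] := gdistP (G_connected x z).
by have := gdist_edge x e; have := min _ w; rewrite E; lia.
Qed.

End Distance.

(** * Distances in the corona *)

Section CoronaDistance.
Variables G H : sgraph.
Hypothesis G_connected : connected_graph G.

(** Nonadjacent vertices of one copy meet through their base vertex, so only adjacency in [H]
    enters, never its metric. *)
Definition corona_dist (u v : corona G H) : nat :=
  match u, v with
  | inl i, inl j => gdist i j
  | inl i, inr (j, _) => (gdist i j).+1
  | inr (i, _), inl j => (gdist i j).+1
  | inr (i, h), inr (j, k) =>
      if i == j then (if h == k then 0 else if edge h k then 1 else 2)%N
      else (gdist i j).+2
  end.

Lemma gdist_corona (u v : corona G H) : gdist u v = corona_dist u v.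
Proof.
move: v; apply: gdist_unique.
- by case: u => [i|[i h]] /=; rewrite ?gdistxx ?eqxx.
- case: u => [i|[i h]] [j|[j k]] [j'|[j' k']] //=.
  + exact: gdist_edge.
  + by move=> /eqP->.
  + by move=> /eqP->; lia.
  + by move=> /andP[/eqP-> _].
  + by move=> e; rewrite ltnS; exact: gdist_edge.
  + by move=> /eqP->; case: eqP => [->|_] //; do 2?case: ifP.
  + by move=> /eqP->; case: eqP => [->|_]; rewrite ?gdistxx; lia.
  + move=> /andP[/eqP-> e]; case: eqP => // _.
    by case: (eqVneq h k) e => [->|_] e; do ?case: ifP => //; rewrite e.
(* The neighbour one step closer to [u] is found along [G] for a base target; for a target in a copy
   it is the base vertex, or [u] itself when adjacent. *)
- case: u => [i|[i h]] [j|[j k]] /= ne.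
  + have ji : j != i by apply: contra_neq ne => ->.
    by have [z e dz] := gdist_descent G_connected ji; exists (inl z).
  + by exists (inl j) => /=.
  + have [->|ji] := eqVneq j i.
      by exists (inr (i, h)) => /=; rewrite ?gdistxx ?eqxx.
    by have [z e dz] := gdist_descent G_connected ji; exists (inl z); rewrite //= dz.
  + have [ij|ij] := eqVneq i j; last by exists (inl j) => /=.
    rewrite -ij in ne *; have [hk|hk] := eqVneq h k; first by rewrite hk eqxx in ne.
    case: ifP => e; last by exists (inl i); rewrite //= ?gdistxx.
    by exists (inr (i, h)); rewrite /= ?eqxx.
Qed.

End CoronaDistance.

(** * Rayleigh quotients and the least eigenvalue *)

Section Rayleigh.
Variable R : realType.

Lemma dot_normalize n (g : 'cV[R]_n) : dot g g != 0 ->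
  exists2 s : R, s ^+ 2 * dot g g = 1 & dot (s *: g) (s *: g) = 1.
Proof.
move=> g0; exists (Num.sqrt (dot g g))^-1.
  by rewrite exprVn sqr_sqrtr ?dot_ge0 // mulVf.
by rewrite dotZl dotZr mulrA -expr2 exprVn sqr_sqrtr ?dot_ge0 // mulVf.
Qed.

Lemma dot_quad_le (n : nat) (A : 'M[R]_n) (c : 'cV[R]_n) (M : R) :
  (forall g, dot g g = 1 -> dot c g = 0 -> dot g (A *m g) <= M) ->
  forall g, dot c g = 0 -> dot g (A *m g) <= M * dot g g.
Proof.
move=> le1 g cg; have [g0|g0] := eqVneq (dot g g) 0.
  by rewrite g0 (dot_eq0 g0) mulmx0 -(scale0r 0) dotZl !(mul0r, mulr0).
have [s s2 /le1] := dot_normalize g0.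
rewrite dotZr cg mulr0 -scalemxAr dotZl dotZr => /(_ erefl).
rewrite mulrA -expr2 => le_M.
have gp : 0 < dot g g by rewrite lt_def g0 dot_ge0.
have <- : dot g g * (s ^+ 2 * dot g (A *m g)) = dot g (A *m g).
  by rewrite mulrA (mulrC (dot g g)) s2 mul1r.
by rewrite mulrC ler_wpM2r // ltW.
Qed.

(** Moving from [f] to [f - t w] with [w = B f] changes the form by [- 2 t <w, w>] to first order,
    so a small [t > 0] would make it negative unless [w = 0]. *)
Lemma psd_dot_eq0 n (B : 'M[R]_n) (f : 'cV[R]_n) :
  B^T = B -> (forall g, 0 <= dot g (B *m g)) -> dot f (B *m f) = 0 ->
  B *m f = 0.
Proof.
move=> symB psd fBf; apply: dot_eq0; set w := B *m f.
have fBw : dot f (B *m w) = dot w w by rewrite dot_mulmx symB.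
have quad t : 0 <= - (2 * t * dot w w) + t ^+ 2 * dot w (B *m w).
  have := psd (f + (- t) *: w).
  rewrite mulmxDr -scalemxAr -/w !(dotDl, dotDr, dotZl, dotZr) fBw fBf.
  by congr (0 <= _); ring.
have p0 := dot_ge0 w; have r0 := psd w.
move: quad p0 r0; move: (dot w w) (dot w (B *m w)) => p r quad p0 r0.
have r1 : r + 1 != 0 by rewrite gt_eqF // ltr_wpDl.
(* Adding 1 keeps the denominator positive; with [p = t (r + 1)] the inequality becomes
   [0 <= - t^2 (r + 2)]. *)
have := quad (p / (r + 1)); set t := p / (r + 1).
have -> : p = t * (r + 1) by rewrite /t divfK.
move=> H; have t0 : t ^+ 2 <= 0 by nra.
have -> : t = 0 by apply/eqP; rewrite -sqrf_eq0 eq_le t0 sqr_ge0.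
by rewrite mul0r.
Qed.

(** If the form has minimum [m] on unit vectors, attained at [f], then [A - m] is positive
    semidefinite with form 0 at [f]; so [m] is an eigenvalue and [min_ev A <= m]. *)
Lemma min_ev_rayleigh n (A : 'M[R]_n) (g : 'cV[R]_n) : A^T = A ->
  min_ev A * dot g g <= dot g (A *m g).
Proof.
move=> symA; have dot0 (u : 'cV[R]_n) : dot 0 u = 0.
  by rewrite -(scale0r 0) dotZl mul0r.
have [g0|g0] := eqVneq (dot g g) 0.
  by rewrite g0 (dot_eq0 g0) dot0 mulr0.
have n_gt0 : (0 < n)%N.
  by case: n A g g0 {symA dot0} => // A g; rewrite /dot big_ord0 eqxx.
have [_ lb] := min_ev_min n_gt0 symA.
(* The zero vector imposes no linear constraint, and the sign turns the maximum into a minimum. *)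
have [|f [f1 _] fmax] := @quad_max _ _ (- A) 0.
  by have [s _ s1] := dot_normalize g0; exists (s *: g).
set m := dot f (A *m f).
have dN u : dot u (- A *m u) = - dot u (A *m u).
  by rewrite mulNmx -scaleN1r dotZr mulN1r.
have ray u : m * dot u u <= dot u (A *m u).
  rewrite -lerN2 -dN -mulNr; apply: (@dot_quad_le _ _ 0) => // v v1 v0.
  by rewrite -dN; apply: fmax.
apply: le_trans (ray g); apply: ler_wpM2r; rewrite ?dot_ge0 //.
apply: lb; apply/eigenvalueP.
have BE u : (A - m%:M) *m u = A *m u + (- m) *: u.
  by rewrite mulmxBl mul_scalar_mx scaleNr.
have Bf0 : (A - m%:M) *m f = 0.
  apply: psd_dot_eq0; first by rewrite linearB /= symA tr_scalar_mx.
    by move=> u; rewrite BE dotDr dotZr mulNr subr_ge0.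
  by rewrite BE dotDr dotZr f1 -/m mulr1 subrr.
have Af : A *m f = m *: f.
  by apply/eqP; rewrite -subr_eq0 -scaleNr -BE Bf0.
exists f^T; first by rewrite -{1}symA -trmx_mul Af linearZ.
apply: contra_eq_neq f1 => /(congr1 trmx); rewrite trmxK trmx0 => ->.
by rewrite dot0 eq_sym oner_eq0.
Qed.

End Rayleigh.

(** * Quadratic forms on functions of the vertices *)

Section Functions.
Variable R : realType.

Definition colf (T : finType) (f : T -> R) : 'cV[R]_#|T| :=
  \col_i f (enum_val i).

Lemma colfP (T : finType) (v : 'cV[R]_#|T|) :
  v = colf (fun x => v (enum_rank x) 0).
Proof. by apply/colP => i; rewrite mxE enum_valK. Qed.

Lemma sum_enum_val (T : finType) (F : T -> R) :
  \sum_(i < #|T|) F (enum_val i) = \sum_x F x.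
Proof.
rewrite [RHS](reindex (@enum_val T T)) //=; exists enum_rank => x _.
  exact: enum_valK.
exact: enum_rankK.
Qed.

Lemma dot_colf (T : finType) (f g : T -> R) :
  dot (colf f) (colf g) = \sum_x f x * g x.
Proof. by rewrite -sum_enum_val; apply: eq_bigr => i _; rewrite !mxE. Qed.

Lemma dot1_colf (T : finType) (f : T -> R) :
  dot (const_mx 1) (colf f) = \sum_x f x.
Proof. by rewrite -sum_enum_val; apply: eq_bigr => i _; rewrite !mxE mul1r. Qed.

Lemma distmx_colf (G : sgraph) (f : G -> R) :
  distmx R G *m colf f = colf (fun x => \sum_y (gdist x y)%:R * f y).
Proof.
apply/colP => i; rewrite !mxE -[RHS]sum_enum_val.
by apply: eq_bigr => j _; rewrite !mxE.
Qed.

Lemma adjmx_colf (G : sgraph) (f : G -> R) :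
  adjmx R G *m colf f = colf (fun x => \sum_y (edge x y)%:R * f y).
Proof.
apply/colP => i; rewrite !mxE -[RHS]sum_enum_val.
by apply: eq_bigr => j _; rewrite !mxE.
Qed.

Lemma adjmx_sym (G : sgraph) : (adjmx R G)^T = adjmx R G.
Proof. by apply/matrixP => i j; rewrite !mxE edge_sym. Qed.

Definition dist_form (G : sgraph) (f : G -> R) : R :=
  \sum_x f x * \sum_y (gdist x y)%:R * f y.

Lemma dist_form_le (G : sgraph) (f : G -> R) : (1 < #|G|)%N ->
  \sum_x f x = 0 -> dist_form f <= QEC R G * \sum_x f x * f x.
Proof.
move=> /(@QEC_max R)[_ ub] f0.
rewrite /dist_form -!dot_colf -distmx_colf.
apply: (@dot_quad_le R _ _ (const_mx 1)) => [g g1 g0|]; last by rewrite dot1_colf.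
by apply: ub; exists g.
Qed.

(** Attainment serves both bounds: on the corona for the upper one, on [G] for the lower one. *)
Lemma dist_form_max (G : sgraph) : (1 < #|G|)%N ->
  exists f : G -> R, [/\ \sum_x f x = 0, \sum_x f x * f x = 1 &
                         dist_form f = QEC R G].
Proof.
move=> /(@QEC_max R)[[g [g1 g0] gE] _].
rewrite (colfP g) distmx_colf !dot_colf dot1_colf in g1 g0 gE.
by exists (fun x => g (enum_rank x) 0).
Qed.

End Functions.

(** * The distance form of the corona *)

Section Corona.
Variables (R : realType) (G H : sgraph).
Hypothesis G_connected : connected_graph G.

Lemma sum_corona (F : corona G H -> R) :
  \sum_x F x = \sum_i (F (inl i) + \sum_h F (inr (i, h))).
Proof.
rewrite /= big_sumType big_split /=; congr (_ + _).
by rewrite pair_big; apply: eq_bigr => -[].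
Qed.

Definition fiber_sum (f : corona G H -> R) (i : G) : R :=
  f (inl i) + \sum_h f (inr (i, h)).

(** Give base vertices height 0 and copy vertices height 1. A distance is the one in [G] plus both
    heights, less 2 or 1 for equal or adjacent vertices of one copy; the heights contribute a
    multiple of the total of [f], which is 0. *)
Lemma dist_form_corona (f : corona G H -> R) : \sum_x f x = 0 ->
  dist_form f = dist_form (fiber_sum f) -
    \sum_i \sum_h f (inr (i, h)) *
      (2 * f (inr (i, h)) + \sum_k (edge h k)%:R * f (inr (i, k))).
Proof.
move=> f0; set Wt := \sum_j \sum_k f (inr (j, k)).
pose Ds i := \sum_j (gdist i j)%:R * fiber_sum f j.
have Dl i : \sum_y (gdist (inl i : corona G H) y)%:R * f y = Ds i + Wt.
  rewrite sum_corona /Ds /Wt -big_split; apply: eq_bigr => j _ /=.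
  rewrite /fiber_sum gdist_corona //= mulrDr -addrA; congr (_ + _).
  rewrite mulr_sumr -big_split; apply: eq_bigr => k _ /=.
  by rewrite gdist_corona //= -natr1 mulrDl mul1r.
have Dr i h : \sum_y (gdist (inr (i, h) : corona G H) y)%:R * f y = Ds i + Wt
    - (2 * f (inr (i, h)) + \sum_k (edge h k)%:R * f (inr (i, k))).
  (* The inserted zero total accounts for the height of [(i, h)]; the correction is then spread over
     all copies so that sums match termwise. *)
  rewrite -[X in X + Wt]addr0 -[X in _ + X + Wt]f0 !sum_corona /Ds /Wt.
  rewrite (_ : 2 * _ + _ = \sum_j \sum_k (i == j)%:R *
     ((2 * (h == k)%:R + (edge h k)%:R) * f (inr (j, k)))); last first.
    rewrite [RHS](bigD1 i) //= [X in _ = _ + X]big1 => [|j /negPf ji]; last first.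
      by rewrite big1 // => k _; rewrite eq_sym ji mul0r.
    rewrite addr0 eqxx (_ : f (inr (i, h)) = \sum_k (h == k)%:R * f (inr (i, k))).
      rewrite mulr_sumr -big_split; apply: eq_bigr => k _ /=.
      by ring.
    rewrite (bigD1 h) //= big1 => [|k /negPf kh]; rewrite ?eqxx ?mul1r ?addr0 //.
    by rewrite eq_sym kh mul0r.
  rewrite -sumrN -!big_split; apply: eq_bigr => j _ /=.
  rewrite gdist_corona //= /fiber_sum.
  rewrite (_ : \sum_k _ = \sum_k ((gdist i j)%:R + 2 - (i == j)%:R *
     (2 * (h == k)%:R + (edge h k)%:R)) * f (inr (j, k))); last first.
    apply: eq_bigr => k _; rewrite gdist_corona //=; congr (_ * _).
    have [<-|_] := eqVneq i j; last by rewrite mul0r subr0 -addn2 natrD.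
    rewrite gdistxx; have [<-|_] := eqVneq h k; first by rewrite edge_irr /=; ring.
    by case: ifP => _ /=; ring.
  rewrite (_ : \sum_k _ = ((gdist i j)%:R + 2) * (\sum_k f (inr (j, k))) -
    \sum_k (i == j)%:R * ((2 * (h == k)%:R + (edge h k)%:R) * f (inr (j, k)))).
    by rewrite -natr1; ring.
  rewrite mulr_sumr -sumrB; apply: eq_bigr => k _; ring.
rewrite /dist_form sum_corona.
under eq_bigr => i _ do rewrite Dl.
transitivity (\sum_i (fiber_sum f i * (Ds i + Wt) - \sum_h f (inr (i, h)) *
      (2 * f (inr (i, h)) + \sum_k (edge h k)%:R * f (inr (i, k))))).
  apply: eq_bigr => i _; under eq_bigr => h _ do rewrite Dr mulrBr.
  by rewrite sumrB -mulr_suml /fiber_sum mulrDl addrA.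
rewrite sumrB; congr (_ - _); under eq_bigr => i _ do rewrite mulrDr.
rewrite big_split /= -mulr_suml -[X in _ + X * _]sum_corona f0 mul0r addr0.
by [].
Qed.

End Corona.

(** * The adjacency form of a regular graph *)

Section Regular.
Variables (R : realType) (H : sgraph) (kappa : nat).
Hypothesis H_regular : regular_graph kappa H.

Lemma sum_edge (x : H) : \sum_y (edge x y)%:R = kappa%:R :> R.
Proof.
rewrite -natr_sum; congr (_%:R).
by rewrite -(H_regular x) -sum1dep_card [RHS]big_mkcond; apply: eq_bigr => y _; case: edge.
Qed.

Lemma adjmx_mul1 :
  adjmx R H *m const_mx 1 = kappa%:R *: const_mx 1 :> 'cV_#|H|.
Proof.
have -> : const_mx 1 = colf (fun=> 1) :> 'cV[R]_#|H| by apply/colP => i; rewrite !mxE.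
rewrite adjmx_colf; apply/colP => i; rewrite !mxE mulr1 -[RHS](sum_edge (enum_val i)).
by apply: eq_bigr => y _; rewrite mulr1.
Qed.

(** By regularity the all-ones vector is an eigenvector, so the form of [adjmx R H + t] splits
    orthogonally: the constant part of [V] gives the left side, and the rest [Z] contributes a
    nonnegative amount. *)
Lemma regular_min_ev_le (V : 'cV[R]_#|H|) (t : R) :
  (0 < #|H|)%N -> 0 <= min_ev (adjmx R H) + t ->
  (kappa%:R + t) / #|H|%:R * dot (const_mx 1) V ^+ 2 <=
  dot V (adjmx R H *m V) + t * dot V V.
Proof.
move=> H0 tge; set w := dot _ V; set n : R := #|H|%:R.
have n0 : n != 0 by rewrite pnatr_eq0 -lt0n.
have d11 : dot (const_mx 1 : 'cV[R]_#|H|) (const_mx 1) = n.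
  rewrite /dot (eq_bigr (fun=> 1)) => [|i _]; last by rewrite !mxE mulr1.
  by rewrite sumr_const card_ord.
have d1A : dot (const_mx 1) (adjmx R H *m V) = kappa%:R * w.
  by rewrite dot_mulmx adjmx_sym adjmx_mul1 dotZl.
pose Z := V + (- (w / n)) *: const_mx 1.
have := min_ev_rayleigh Z (adjmx_sym R H); have := mulr_ge0 tge (dot_ge0 Z).
rewrite mulrDl => h1 h2; have {h1 h2} : 0 <= dot Z (adjmx R H *m Z) + t * dot Z Z by lra.
rewrite /Z mulmxDr -scalemxAr adjmx_mul1 !(dotDl, dotDr, dotZl, dotZr).
rewrite d11 d1A (dotC V (const_mx 1)) -/w => h; rewrite -subr_ge0; move: h; congr (0 <= _).
by field.
Qed.

End Regular.

(** * The quadratic whose larger root is [Psi], with [m] for [kappa + 2] *)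

Section Root.
Variables (R : rcfType) (n m q : R).
Hypotheses (n0 : 0 < n) (m0 : 0 < m).
Let b := (n + 1) * q - m.
Let x := 2^-1 * (b + Num.sqrt (b ^+ 2 + 4 * m * q)).

(** Four times the polynomial is [(2 y - b)^2] minus the discriminant. *)
Lemma quad_root_ge y : y ^+ 2 - b * y - m * q <= 0 -> y <= x.
Proof.
move=> py; suff : 2 * y - b <= Num.sqrt (b ^+ 2 + 4 * m * q) by rewrite /x; lra.
apply: le_trans (ler_norm _) _; rewrite -sqrtr_sqr ler_wsqrtr //.
by rewrite -subr_ge0 (_ : _ - _ = - 4 * (y ^+ 2 - b * y - m * q)); [lra|ring].
Qed.

(* [- m / (n + 1)] lies below the root: the polynomial equals
   [(y - q) * (y * (n + 1) + m) - n * y ^+ 2], which is [- n * y ^+ 2] there. *)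
Let y0 := - m / (n + 1).

Let y0E : y0 ^+ 2 - b * y0 - m * q = - (n * y0 ^+ 2).
Proof. by rewrite /y0 /b; field; rewrite gt_eqF // addr_gt0. Qed.

Let ny0 : 0 < n * y0 ^+ 2.
Proof.
by rewrite mulr_gt0 // exprn_even_gt0 //= mulf_neq0 ?oppr_eq0 ?invr_eq0 ?gt_eqF ?addr_gt0.
Qed.

(** The point is that the discriminant is nonnegative even for negative [q], because the polynomial
    is negative at [y0]. *)
Lemma quad_rootE : x ^+ 2 = b * x + m * q.
Proof.
have D0 : 0 <= b ^+ 2 + 4 * m * q.
  rewrite (_ : _ + _ = (2 * y0 - b) ^+ 2 - 4 * (y0 ^+ 2 - b * y0 - m * q)); last by ring.
  by rewrite y0E; have := sqr_ge0 (2 * y0 - b); have := ny0; lra.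
have := sqr_sqrtr D0; rewrite /x; move: (Num.sqrt _) => s s2.
rewrite (_ : (2^-1 * (b + s)) ^+ 2 = 4^-1 * (b ^+ 2 + 2 * b * s + s ^+ 2)); last by field.
by rewrite s2; field.
Qed.

(** [quad_root_ge] puts [y0] weakly below the root, and strictly so since the polynomial vanishes
    only at the latter. *)
Lemma quad_root_gt : 0 < x * (n + 1) + m.
Proof.
have n1 : 0 < n + 1 by rewrite addr_gt0.
have y0x : y0 < x.
  rewrite lt_neqAle quad_root_ge ?andbT; last by rewrite y0E; have := ny0; lra.
  apply/eqP => xy; have := quad_rootE; have := y0E; rewrite -xy; have := ny0; lra.
by move: y0x; rewrite /y0 ltr_pdivrMr //; lra.
Qed.

Lemma quad_root_factor : (x - q) * (x * (n + 1) + m) = n * x ^+ 2.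
Proof.
apply/eqP; rewrite -subr_eq0 (_ : _ - _ = x ^+ 2 - (b * x + m * q)).
  by rewrite quad_rootE subrr.
by rewrite /b; ring.
Qed.

(** Clearing a positive denominator says that the polynomial is negative at [g]. Otherwise
    [g <= y0], already below the root; this covers a zero denominator, where the quotient is 0 by
    convention. *)
Lemma quad_root_ge_of_bound (g : R) :
  (g ^+ 2 + g * m) / (g * (n + 1) + m) < q -> g <= x.
Proof.
have [D0|D0] := ltP 0 (g * (n + 1) + m).
  rewrite ltr_pdivrMr // => h; apply: quad_root_ge.
  by rewrite (_ : _ - _ = g ^+ 2 + g * m - q * (g * (n + 1) + m)); [lra|rewrite /b; ring].
move=> _; have n1 : 0 < n + 1 by rewrite addr_gt0.
by rewrite -(ler_pM2r n1); have := quad_root_gt; lra.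
Qed.

Lemma quad_root_ge0 : 0 <= q -> 0 <= x.
Proof.
move=> q0; apply: quad_root_ge; rewrite expr2 !mulr0 subr0 sub0r oppr_le0.
by rewrite mulr_ge0 // ltW.
Qed.

End Root.

(** * The two bounds for the corona *)

Section CoronaQEC.
Variables (R : realType) (G H : sgraph) (kappa : nat).
Hypotheses (G_connected : connected_graph G) (G_card : (1 < #|G|)%N).
Hypotheses (H_card : (0 < #|H|)%N) (H_regular : regular_graph kappa H).
Let n : R := #|H|%:R.
Let m : R := kappa%:R + 2.
Variable Psi : R.
Let a := Psi * (n + 1) + m.
Hypotheses (a_gt0 : 0 < a) (PsiE : (Psi - QEC R G) * a = n * Psi ^+ 2).

Let n_gt0 : 0 < n. Proof. by rewrite ltr0n. Qed.

Let corona_card : (1 < #|corona G H|)%N.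
Proof. by rewrite /= card_sum ltn_addr. Qed.

(** The contribution of one vertex of [G]: [V] holds the values on its copy and [s] its fiber sum,
    so [s] minus the sum of [V] is the value at the vertex itself. *)
Let fiber_le (V : 'cV[R]_#|H|) (s : R) : - 2 - min_ev (adjmx R H) <= Psi ->
  QEC R G * s ^+ 2 - (2 * dot V V + dot V (adjmx R H *m V)) <=
  Psi * ((s - dot (const_mx 1) V) ^+ 2 + dot V V).
Proof.
move=> Psi_ge; have /(regular_min_ev_le H_regular V H_card) : 0 <= min_ev (adjmx R H) + (2 + Psi).
  by lra.
rewrite -/n; set w := dot (const_mx 1) V; set q := QEC R G.
suff : 0 <= (Psi - q) * s ^+ 2 - 2 * Psi * s * w + (a / n) * w ^+ 2.
  rewrite (_ : a / n = Psi + (kappa%:R + (2 + Psi)) / n); first lra.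
  by rewrite /a /m; field; rewrite gt_eqF.
(* By [PsiE] the binary form has zero discriminant: multiplied by [a n] it is a perfect square. *)
have an : 0 < a * n by rewrite mulr_gt0.
rewrite -(pmulr_rge0 _ an).
rewrite (_ : a * n * _ = (n * Psi * s - a * w) ^+ 2); first exact: sqr_ge0.
transitivity (n * s ^+ 2 * ((Psi - q) * a) - 2 * Psi * s * w * (a * n) + a ^+ 2 * w ^+ 2).
  by field; rewrite gt_eqF.
by rewrite PsiE; ring.
Qed.

Lemma QEC_corona_le : - 2 - min_ev (adjmx R H) <= Psi ->
  QEC R (corona G H) <= Psi.
Proof.
move=> Psi_ge; have [f [f0 f1 <-]] := dist_form_max R corona_card.
rewrite -[leRHS]mulr1 -[X in _ <= _ * X]f1 dist_form_corona // sum_corona.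
have s0 : \sum_i fiber_sum f i = 0 by rewrite -[RHS]f0 sum_corona.
set S := \sum_i \sum_h _.
apply: (@le_trans _ _ (QEC R G * (\sum_i fiber_sum f i * fiber_sum f i) - S)).
  by rewrite lerD2r dist_form_le.
rewrite /S {S}.
rewrite !mulr_sumr -sumrB; apply: ler_sum => i _.
have := fiber_le (colf (fun h => f (inr (i, h)))) (fiber_sum f i) Psi_ge.
rewrite adjmx_colf !dot_colf dot1_colf {2}/fiber_sum addrK -!expr2.
congr (_ - _ <= _); rewrite mulr_sumr -big_split; apply: eq_bigr => h _ /=.
by rewrite mulrDr mulrCA.
Qed.

(* Extremal vector: spread an optimal [g] for [G] with constant weight
   [Psi / a * g i] on the copy of [H] at [i], keeping the fiber sums equal to [g]. *)
Lemma QEC_corona_ge : Psi <= QEC R (corona G H).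
Proof.
have [g [g0 g1 gq]] := dist_form_max R G_card.
(* Chosen so that the square in [fiber_le] vanishes: [n Psi s = a w] with copy sum [w = n c s]. *)
pose c := Psi / a.
pose f (u : corona G H) := match u with
  inl i => (1 - n * c) * g i | inr (i, _) => c * g i end.
have sH (z : R) : \sum_(h : H) z = n * z by rewrite sumr_const mulr_natl.
have fs i : fiber_sum f i = g i by rewrite /fiber_sum /f /= sH; ring.
have f0 : \sum_u f u = 0.
  by rewrite sum_corona -[RHS]g0; apply: eq_bigr => i _; exact: fs.
pose N := (1 - n * c) ^+ 2 + n * c ^+ 2.
have fN : \sum_u f u * f u = N.
  rewrite sum_corona -[RHS]mulr1 -[X in _ = _ * X]g1 mulr_sumr; apply: eq_bigr => i _.
  by rewrite /= sH /N; ring.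
have N0 : 0 < N.
  have [c0|c0] := eqVneq c 0; first by rewrite /N c0 mulr0 subr0 expr1n expr0n mulr0 addr0.
  by rewrite /N ltr_wpDl ?sqr_ge0 // mulr_gt0 // exprn_even_gt0.
have := dist_form_le corona_card f0.
rewrite fN dist_form_corona // (_ : dist_form _ = QEC R G); last first.
  by rewrite -gq /dist_form; apply: eq_bigr => i _; rewrite fs;
    congr (_ * _); apply: eq_bigr => j _; rewrite fs.
(* By regularity, [2 + adjmx R H] acts as [m] on vectors constant on a copy. *)
rewrite (_ : \sum_i _ = n * m * c ^+ 2); last first.
  rewrite -[RHS]mulr1 -[X in _ = _ * X]g1 mulr_sumr; apply: eq_bigr => i _.
  rewrite (eq_bigr (fun=> m * c ^+ 2 * (g i * g i))) ?sH; first by ring.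
  by move=> h _ /=; rewrite -mulr_suml (sum_edge R H_regular) /m; ring.
rewrite (_ : _ - _ = Psi * N); first by rewrite ler_pM2r.
have -> : QEC R G = Psi - n * Psi ^+ 2 / a by rewrite -PsiE mulfK ?gt_eqF //; ring.
by rewrite /N /c /a; field; rewrite gt_eqF.
Qed.

End CoronaQEC.

Theorem theorem4 (R : realType) (G H : sgraph) (kappa : nat)
    (G_connected : connected_graph G) (G_card : (2 <= #|G|)%N)
    (H_card : (1 <= #|H|)%N) (H_regular : regular_graph kappa H) :
  let n : R := #|H|%:R in
  let k : R := kappa%:R in
  let q : R := QEC R G in
  let A_H : 'M[R]_#|H| := adjmx R H in
  let gamma3 : R := - 2 - min_ev A_H in
  let Psi : R :=
    2^-1 * ((n + 1) * q - (k + 2)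
            + Num.sqrt (((n + 1) * q - (k + 2)) ^+ 2 + 4 * (k + 2) * q)) in
  let bound : R :=
    (gamma3 ^+ 2 + gamma3 * (k + 2)) / (gamma3 * (n + 1) + k + 2) in
  [/\ ~ ev A_H (- 2 - Psi), bound < q, q < 0 & gamma3 < 0] \/
  [/\ ~ ev A_H (- 2 - Psi), 0 < q & gamma3 <= 0] \/
  [/\ ~ ev A_H (- 2 - Psi), bound < q & 0 < gamma3] ->
  QEC R (corona G H) = Psi.
Proof.
move=> n k q A_H gamma3 Psi bound hyp.
have n_gt0 : 0 < n by rewrite ltr0n.
have m_gt0 : 0 < k + 2 by rewrite ltr_wpDl ?ler0n.
have bound_le : bound < q -> gamma3 <= Psi.
  by rewrite /bound -addrA; exact: quad_root_ge_of_bound.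
(* Conditions (i) and (iii) contain [bound < q]; under (ii), [gamma3 <= 0 <= Psi]. *)
have Psi_ge : gamma3 <= Psi.
  case: hyp => [[_ /bound_le]|[[_ q0 g0]|[_ /bound_le]]] //.
  by apply: le_trans g0 _; apply: quad_root_ge0 (ltW q0).
have a_gt0 := quad_root_gt q n_gt0 m_gt0.
have PsiE := quad_root_factor q n_gt0 m_gt0.
apply/eqP; rewrite eq_le; apply/andP; split.
  by apply: (QEC_corona_le G_connected G_card H_card H_regular a_gt0 PsiE).
by apply: (QEC_corona_ge G_connected G_card H_card H_regular a_gt0 PsiE).
Qed.
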